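(* Let $G$ be a gyrogroup and let $\mathbb{F}$ be a field. Then $G$ acts linearly on $L^{\mathrm{gyr}}(G)$ by $$a\cdot f = f\circ L_{\ominus a}$$ for all $a\in G$, $f\in L^{\mathrm{gyr}}(G)$.
   Context: A gyrogroup is a nonempty set $G$ with a binary operation $\oplus$ such that: (G1) there is an element $e\in G$ with $e\oplus a=a$ for all $a\in G$; (G2) for each $a\in G$ there is $b\in G$ with $b\oplus a=e$; (G3) for all $a,b\in G$ there is an automorphism $\mathrm{gyr}[a,b]$ of $(G,\oplus)$ (a bijection of $G$ preserving $\oplus$) such that $a\oplus(b\oplus c)=(a\oplus b)\oplus \mathrm{gyr}[a,b]c$ for all $c\in G$; (G4) $\mathrm{gyr}[a\oplus b,b]=\mathrm{gyr}[a,b]$ for all $a,b\in G$. In any gyrogroup, $e$ is the unique two-sided identity and each $a$ has a unique two-sided inverse, denoted $\ominus a$. ($G$ may be infinite.) $L(G)$ is the $\mathbb{F}$-vector space of all functions $G\to\mathbb{F}$ with pointwise operations, and $$L^{\mathrm{gyr}}(G)=\{f\in L(G)\colon \forall a,x,y,z\in G,\ f(a\oplus\mathrm{gyr}[x,y]z)=f(a\oplus z)\},$$ a subspace of $L(G)$. For $a\in G$, $L_a\colon G\to G$ is the map $L_a(x)=a\oplus x$. A linear action of $G$ on an $\mathbb{F}$-vector space $V$ is a map $G\times V\to V$, $(a,v)\mapsto a\cdot v$, such that (1) $e\cdot v=v$ for all $v\in V$; (2) $a\cdot(b\cdot v)=(a\oplus b)\cdot v$ for all $a,b\in G$, $v\in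 V$; (3) for each $a\in G$, the map $v\mapsto a\cdot v$ is a linear transformation on $V$. In this case $G$ is said to act linearly on $V$. *)

(* Defs.v *)
From HB Require Import structures.
From mathcomp Require Import all_boot all_algebra all_classical.

Set Implicit Arguments.
Unset Strict Implicit.
Unset Printing Implicit Defensive.

Import GRing.Theory.
Local Open Scope ring_scope.

Declare Scope gyro_scope.
Delimit Scope gyro_scope with gyro.

(* The gyroautomorphisms are recorded as data, since gyr_loop compares them
   across different indices; by left cancellation (gyro_addI below) they are
   determined by the operation through gyro_assoc. *)
HB.mixin Record isGyrogroup (G : Type) := {
  gyro_id : G;
  gyro_op : G -> G -> G;
  gyr : G -> G -> G -> G;
  gyro_add0g : forall a, gyro_op gyro_id a = a;
  gyro_left_inv : forall a, exists b, gyro_op b a = gyro_id;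
  gyr_bij : forall a b, bijective (gyr a b);
  gyr_morph : forall a b, {morph gyr a b : x y / gyro_op x y};
  gyro_assoc : forall a b c,
    gyro_op a (gyro_op b c) = gyro_op (gyro_op a b) (gyr a b c);
  gyr_loop : forall a b, gyr (gyro_op a b) b = gyr a b
}.

#[short(type="gyrogroupType")]
HB.structure Definition Gyrogroup := {G of isGyrogroup G}.

Notation "a ⊕ b" := (gyro_op a b)
  (at level 50, left associativity) : gyro_scope.
Local Open Scope gyro_scope.

(* The axiom only gives some left inverse; gyro_addNg, gyro_addgN and
   ominus_unique show that it is unique and two-sided. *)
Definition ominus (G : gyrogroupType) (a : G) : G := sval (cid (gyro_left_inv a)).

Notation "⊖ a" := (ominus a) (at level 35, right associativity) : gyro_scope.

Section GyrogroupTheory.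
Variable G : gyrogroupType.
Implicit Types a b c : G.
Local Notation e := (@gyro_id G).

Lemma gyro_addI a : injective (gyro_op a).
Proof.
move=> b c eq_abc; have [x xa] := gyro_left_inv a.
apply: (bij_inj (gyr_bij x a)).
by rewrite -[LHS]gyro_add0g -[RHS]gyro_add0g -xa -!gyro_assoc eq_abc.
Qed.

Lemma gyr0g a b : gyr e a b = b.
Proof.
by apply: (@gyro_addI a); rewrite -{1}[a]gyro_add0g -gyro_assoc gyro_add0g.
Qed.

Lemma gyro_left_invK a b c : b ⊕ a = e -> b ⊕ (a ⊕ c) = c.
Proof. by move=> ba; rewrite gyro_assoc -gyr_loop ba gyr0g gyro_add0g. Qed.

Lemma gyro_addg0 a : a ⊕ e = a.
Proof.
have [x xa] := gyro_left_inv a.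
by apply: (@gyro_addI x); rewrite gyro_left_invK.
Qed.

Lemma gyro_left_inv_right a b : b ⊕ a = e -> a ⊕ b = e.
Proof.
by move=> ba; apply: (@gyro_addI b); rewrite gyro_left_invK// gyro_addg0.
Qed.

Lemma gyro_addNg a : ⊖ a ⊕ a = e.
Proof. exact: svalP (cid (gyro_left_inv a)). Qed.

Lemma gyro_addgN a : a ⊕ ⊖ a = e.
Proof. exact: gyro_left_inv_right (gyro_addNg a). Qed.

Lemma ominus_unique a b : b ⊕ a = e -> b = ⊖ a.
Proof.
by move=> /gyro_left_inv_right ab; apply: (@gyro_addI a); rewrite gyro_addgN.
Qed.

End GyrogroupTheory.

Definition left_gyrotranslation (G : gyrogroupType) (a : G) : G -> G :=
  fun x => a ⊕ x.

Section Lgyr.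
Variables (F : fieldType) (G : gyrogroupType).

(* F^o is F as a vector space over itself, so that G -> F^o carries the
   pointwise F-vector space structure. *)
Definition Lgyr_pred : {pred G -> F^o} :=
  fun f => `[< forall a x y z : G, f (a ⊕ gyr x y z) = f (a ⊕ z) >].

Lemma Lgyr_submod_closed : submod_closed Lgyr_pred.
Proof.
split=> [|k f g /asboolP fP /asboolP gP]; apply/asboolP => a x y z //.
by rewrite !fctE fP gP.
Qed.

HB.instance Definition _ :=
  GRing.isSubmodClosed.Build F (G -> F^o) Lgyr_pred
    (GRing.submod_closed_semi Lgyr_submod_closed).

Record Lgyr : Type := MkLgyr {
  Lgyr_fun :> G -> F^o;
  Lgyr_funP : Lgyr_fun \in Lgyr_pred
}.

HB.instance Definition _ := [isSub for Lgyr_fun].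
HB.instance Definition _ := [Choice of Lgyr by <:].
HB.instance Definition _ := [SubChoice_isSubLmodule of Lgyr by <:].

End Lgyr.

Definition is_linear_action (G : gyrogroupType) (F : fieldType)
    (V : lmodType F) (act : G -> V -> V) : Prop :=
  [/\ forall v, act gyro_id v = v,
      forall a b v, act a (act b v) = act (a ⊕ b) v
    & forall a, linear (act a)].

(* Main.v *)
(** A function [f] in [Lgyr F G] ignores gyrations applied to the right
    summand. Hence [f] satisfies [f (a ⊕ (b ⊕ z)) = f ((a ⊕ b) ⊕ z)], and, since
    gyrations are automorphisms, it also ignores gyrations of the left
    summand. Together with [⊖ (a ⊕ b) = gyr a b (⊖ b ⊕ ⊖ a)] this makes
    [f \o L_(⊖ a)] an action, as if [G] were a group. *)
Require Import Defs.
From mathcomp Require Import all_boot all_algebra all_classical.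

Local Open Scope gyro_scope.

Lemma ominus_id (G : gyrogroupType) : ⊖ (@gyro_id G) = gyro_id.
Proof. by rewrite -(@ominus_unique G gyro_id gyro_id) ?gyro_add0g. Qed.

(** Cancel [a ⊕ b] on the left: by [gyro_assoc] the right side becomes [a ⊕ (b ⊕ (⊖ b ⊕ ⊖ a))],
    which collapses to the identity. *)
Lemma ominus_op (G : gyrogroupType) (a b : G) :
  ⊖ (a ⊕ b) = gyr a b (⊖ b ⊕ ⊖ a).
Proof.
apply: (@gyro_addI G (a ⊕ b)).
by rewrite gyro_addgN -gyro_assoc (gyro_left_invK _ (gyro_addgN b)) gyro_addgN.
Qed.

Section LgyrTheory.
Variables (F : fieldType) (G : gyrogroupType).
Implicit Types (f : Lgyr F G) (a b x y z : G).

Lemma Lgyr_gyrr f a x y z : f (a ⊕ gyr x y z) = f (a ⊕ z).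
Proof. by have /asboolP := Lgyr_funP f; apply. Qed.

Lemma Lgyr_gyr f x y z : f (gyr x y z) = f z.
Proof.
by rewrite -[gyr x y z]gyro_add0g -[in RHS](gyro_add0g z) Lgyr_gyrr.
Qed.

Lemma Lgyr_opA f a b z : f (a ⊕ (b ⊕ z)) = f (a ⊕ b ⊕ z).
Proof. by rewrite gyro_assoc Lgyr_gyrr. Qed.

Lemma Lgyr_gyrl f a x y z : f (gyr x y a ⊕ z) = f (a ⊕ z).
Proof.
have [g _ gK] := gyr_bij x y.
(* With [z] written as [gyr x y (g z)], a single gyration covers the whole sum. *)
by rewrite -[z]gK -gyr_morph Lgyr_gyr Lgyr_gyrr.
Qed.

Lemma Lgyr_translate_subproof f a :
  Lgyr_fun f \o left_gyrotranslation (⊖ a) \in Lgyr_pred (F := F) (G := G).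
Proof.
apply/asboolP => b x y z.
(* Regrouping makes [⊖ a ⊕ b] the left summand of the gyrated [z]. *)
by rewrite /= /left_gyrotranslation !Lgyr_opA Lgyr_gyrr.
Qed.

Definition Lgyr_translate a f : Lgyr F G := MkLgyr (Lgyr_translate_subproof f a).

Lemma Lgyr_translate_linear_action : is_linear_action Lgyr_translate.
Proof.
split=> [f | a b f | a k f g]; apply: val_inj; apply/funext => x /=;
  (* Linearity closes here by computation, the operations being pointwise. *)
  rewrite /left_gyrotranslation //.
- by rewrite ominus_id gyro_add0g.
- by rewrite Lgyr_opA ominus_op Lgyr_gyrl.
Qed.

End LgyrTheory.

Theorem theorem4p3 (G : gyrogroupType) (F : fieldType) :
  exists act : G -> Lgyr F G -> Lgyr F G,
    (forall (a : G) (f : Lgyr F G),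
        Lgyr_fun (act a f) = Lgyr_fun f \o left_gyrotranslation (⊖ a)) /\
    is_linear_action act.
Proof.
exists (@Lgyr_translate F G); split=> //.
exact: Lgyr_translate_linear_action.
Qed.
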